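(* Let $\mathcal{C}$ be a Melnikov formation of finite groups and let $(\Gamma,\Lambda)$ be a $\mathcal{C}$-projective pair. If $\Gamma\neq\Lambda$, then $\bigcap_{x\in\Lambda}\Gamma^x=1$.
   Context: A Melnikov formation $\mathcal{C}$ is a family of finite groups closed under fiber products (with respect to epimorphisms) and such that for every short exact sequence $1\to A\to B\to C\to 1$ one has $A,C\in\mathcal{C}$ if and only if $B\in\mathcal{C}$. A pro-$\mathcal{C}$ group is a profinite group all of whose finite continuous quotients are in $\mathcal{C}$. All subgroups of profinite groups are closed and all homomorphisms are continuous. $\Gamma^x=x^{-1}\Gamma x$ is the conjugate subgroup. Let $\Gamma\le\Lambda$ be pro-$\mathcal{C}$ groups. A $\mathcal{C}$-DEP for $(\Gamma,\Lambda)$ consists of groups $A\le B$ and $G\le H$, all in $\mathcal{C}$, and epimorphisms $\mu\colon\Gamma\to A$, $\alpha\colon G\to A$, $\nu\colon\Lambda\to B$, $\beta\colon H\to B$ such that $\nu|_\Gamma=\mu$ and $\beta|_G=\alpha$. A weak solution is a pair $(\eta,\theta)$ of homomorphisms $\eta\colon\Gamma\to G$, $\theta\colon\Lambda\to H$ (not necessarily surjective) with $\alpha\eta=\mu$, $\beta\theta=\nu$ and $\theta|_\Gamma=\eta$. The pair $(\Gamma,\Lambda)$ is $\mathcal{C}$-projective if every $\mathcal{C}$-DEP for it has a weak solution. *)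

(* Defs.v *)
From HB Require Import structures.
From mathcomp Require Import all_boot all_fingroup.
From mathcomp Require Import boolp classical_sets functions topology.

Set Implicit Arguments.
Unset Strict Implicit.
Unset Printing Implicit Defensive.

Import GroupScope.

(* [monoid.Group] is the class of [groupType]; plain [Group] is shadowed by
   the constructor of [{group gT}]. *)
HB.mixin Record isTopologicalGroup L of monoid.Group L & Topological L := {
  mulg_continuous : continuous (fun x : L * L => x.1 * x.2);
  invg_continuous : continuous (fun x : L => x^-1)
}.

#[short(type="topologicalGroupType")]
HB.structure Definition TopologicalGroup :=
  {L of monoid.Group L & Topological L & isTopologicalGroup L}.

Section FiniteGroups.

Section FiberProduct.
Variables (aT bT cT : finGroupType) (A : {group aT}) (B : {group bT}).
Variables (f : {morphism A >-> cT}) (g : {morphism B >-> cT}).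

Definition fiber_product : {set aT * bT} :=
  [set x | [&& x.1 \in A, x.2 \in B & f x.1 == g x.2]].

Lemma fiber_product_group_set : group_set fiber_product.
Proof.
apply/group_setP; split=> [|x y]; first by rewrite !inE !group1 !morph1 /=.
rewrite !inE => /and3P[xA xB /eqP xE] /and3P[yA yB /eqP yE] /=.
by rewrite !groupM //= !morphM // xE yE eqxx.
Qed.

Canonical fiber_product_group := Group fiber_product_group_set.

End FiberProduct.

Definition finite_group_family := forall gT : finGroupType, {group gT} -> Prop.

Implicit Type C : finite_group_family.

Definition fiber_product_closed C : Prop :=
  forall (aT bT cT : finGroupType)
         (A : {group aT}) (B : {group bT}) (D : {group cT})
         (f : {morphism A >-> cT}) (g : {morphism B >-> cT}),
    f @* A = D -> g @* B = D -> C aT A -> C bT B ->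
    C _ (fiber_product_group f g).

Definition short_exact (aT bT cT : finGroupType)
    (A : {group aT}) (B : {group bT}) (D : {group cT})
    (f : {morphism A >-> bT}) (g : {morphism B >-> cT}) : Prop :=
  [/\ 'injm f, f @* A = 'ker g & g @* B = D].

Definition melnikov_formation C : Prop :=
  fiber_product_closed C /\
  forall (aT bT cT : finGroupType)
         (A : {group aT}) (B : {group bT}) (D : {group cT})
         (f : {morphism A >-> bT}) (g : {morphism B >-> cT}),
    short_exact D f g -> (C aT A /\ C cT D <-> C bT B).

End FiniteGroups.

Local Open Scope classical_set_scope.

Definition profinite (L : topologicalGroupType) : Prop :=
  [/\ compact [set: L], hausdorff_space L & totally_disconnected [set: L]].

Section ProfiniteGroups.
Variable L : topologicalGroupType.
Implicit Types (S Gam : set L) (C : finite_group_family).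

Definition closed_subgroup S : Prop :=
  [/\ S 1, (forall x y, S x -> S y -> S (x * y)),
      (forall x, S x -> S x^-1) & closed S].

(* A homomorphism from a subgroup S of L to a finite group A is represented by
   a total function on L, of which only the restriction to S matters. *)
Definition continuous_hom S (gT : finGroupType) (A : {group gT})
    (f : L -> gT) : Prop :=
  [/\ {in S &, {morph f : x y / x * y}},
      f @` S `<=` [set` A] &
      {within S, continuous (f : L -> discrete_topology gT)}].

Definition continuous_epi S (gT : finGroupType) (A : {group gT})
    (f : L -> gT) : Prop :=
  continuous_hom S A f /\ f @` S = [set` A].

Definition pro_family C S : Prop :=
  forall (gT : finGroupType) (Q : {group gT}) (f : L -> gT),
    continuous_epi S Q f -> C gT Q.

Record double_embedding_problem C Gam := DoubleEmbeddingProblem {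
  dep_bT : finGroupType;
  dep_hT : finGroupType;
  dep_A : {group dep_bT};
  dep_B : {group dep_bT};
  dep_G : {group dep_hT};
  dep_H : {group dep_hT};
  dep_mu : L -> dep_bT;
  dep_alpha : {morphism dep_G >-> dep_bT};
  dep_nu : L -> dep_bT;
  dep_beta : {morphism dep_H >-> dep_bT};
  dep_subAB : dep_A \subset dep_B;
  dep_subGH : dep_G \subset dep_H;
  dep_inA : C dep_bT dep_A;
  dep_inB : C dep_bT dep_B;
  dep_inG : C dep_hT dep_G;
  dep_inH : C dep_hT dep_H;
  dep_mu_epi : continuous_epi Gam dep_A dep_mu;
  dep_alpha_epi : dep_alpha @* dep_G = dep_A;
  dep_nu_epi : continuous_epi [set: L] dep_B dep_nu;
  dep_beta_epi : dep_beta @* dep_H = dep_B;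
  dep_nu_mu : {in Gam, dep_nu =1 dep_mu};
  dep_beta_alpha : {in dep_G, dep_beta =1 dep_alpha}
}.

Definition weak_solution C Gam (E : double_embedding_problem C Gam)
    (eta theta : L -> dep_hT E) : Prop :=
  [/\ continuous_hom Gam (dep_G E) eta,
      continuous_hom [set: L] (dep_H E) theta,
      {in Gam, dep_alpha E \o eta =1 dep_mu E},
      dep_beta E \o theta =1 dep_nu E &
      {in Gam, theta =1 eta}].

(* The pair is (Gam, L). *)
Definition projective_pair C Gam : Prop :=
  forall E : double_embedding_problem C Gam,
    exists eta theta, weak_solution (E := E) eta theta.

End ProfiniteGroups.

(* Main.v *)
Require Import Defs.
From HB Require Import structures.
From mathcomp Require Import all_boot all_fingroup.
From mathcomp Require Import boolp classical_sets functions topology.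

(** We show more: Gam is malnormal, i.e., g = 1 whenever g and g ^ x lie in Gam and
    x does not. Otherwise choose a finite quotient nu : L -> B, with A = nu(Gam),
    such that nu(x) is not in A and nu(g ^ x) <> 1. In the wreath product H of A by B,
    whose base group consists of the A-valued functions on A\B, let G be the
    isomorphic copy of A formed by the pairs (a at the coset A and 1 elsewhere, a).
    In a weak solution theta, each y in Gam is sent to the element of G over nu(y),
    and comparing the base components of theta(x) theta(g ^ x) = theta(g) theta(x)
    at the coset of nu(x)^-1, which is not A, gives nu(g ^ x) = 1. *)

Set Implicit Arguments.
Unset Strict Implicit.
Unset Printing Implicit Defensive.

Import GroupScope.

(** * Closure properties of Melnikov formations *)

Section MelnikovFormations.
Variable C : finite_group_family.
Hypothesis hC : melnikov_formation C.

Lemma melnikov_extension (gT rT : finGroupType) (K G : {group gT})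
    (f : {morphism G >-> rT}) : K :=: 'ker f ->
  C K /\ C (f @* G)%G <-> C G.
Proof.
move=> KE; apply: (hC.2 _ _ _ _ _ _ (idm_morphism K) f).
by split; rewrite ?injm_idm //= morphim_idm.
Qed.

Lemma melnikov_trivial (gT rT : finGroupType) (G : {group gT}) :
  C G -> C (1%G : {group rT}).
Proof.
move=> CG; have := (melnikov_extension (f := @triv_morph _ rT G) (K := G) _).2 CG.
rewrite ker_trivm => /(_ erefl)[_].
by congr C; apply/val_inj; rewrite /= morphim_trivm.
Qed.

(** Invariance under isomorphism is not an axiom; it is the exact-sequence axiom for a trivial
    kernel. *)
Lemma melnikov_isom (gT rT : finGroupType) (G : {group gT})
    (f : {morphism G >-> rT}) : 'injm f -> C G <-> C (f @* G)%G.
Proof.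
move=> injf.
have := melnikov_extension (f := f) (K := 1%G) (esym (trivgP injf)).
by split=> [/H[]//|CfG]; apply/H; split=> //; exact: melnikov_trivial CfG.
Qed.

Lemma melnikov_normal (gT : finGroupType) (N G : {group gT}) :
  N <| G -> C G -> C N.
Proof.
move=> nNG CG.
have kerE : N :=: 'ker (restrm (normal_norm nNG) (coset N)).
  by rewrite ker_restrm ker_coset (finset.setIidPr (normal_sub nNG)).
by have [] := (melnikov_extension kerE).2 CG.
Qed.

(** The [e i] make [K] a subdirect subgroup of a power of [A]. Coordinates are peeled off one at a
    time: the kernel of [e i] is detected by the remaining ones, and the image is normal in [A]. *)
Lemma melnikov_subpower (I : finType) (kT aT : finGroupType) (K : {group kT})
    (A : {group aT}) (e : I -> {morphism K >-> aT}) :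
    (forall i, e i @* K = A) ->
    (forall x, x \in K -> (forall i, e i x = 1) -> x = 1) ->
  C A -> C K.
Proof.
move=> eA einj CA.
(* Stated for all normal subgroups of [K], so that the induction can pass from [N] to
   [N :&: 'ker (e i)]. *)
suff gen (s : seq I) (N : {group kT}) : N <| K ->
    (forall x, x \in N -> {in s, forall i, e i x = 1} -> x = 1) -> C N.
  apply: (gen (enum I) K (normal_refl K)) => x xK ex.
  by apply: einj => // i; apply: ex; rewrite mem_enum.
elim: s N => [|i s IHs] N nNK Ninj.
  have -> : N = 1%G by apply/trivGP/fintype.subsetP => x xN; rewrite inE (Ninj x xN).
  exact: melnikov_trivial CA.
have sNK := normal_sub nNK.
have kerE : (N :&: 'ker (e i))%G :=: 'ker (restrm sNK (e i)) by rewrite ker_restrm.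
apply/(melnikov_extension kerE); split.
  apply: IHs => [|x]; first by rewrite normalI // ker_normal.
  rewrite inE => /andP[xN /mker exi] exs; apply: Ninj => // j.
  by rewrite inE => /predU1P[->|/exs].
apply: (melnikov_normal _ CA).
by rewrite /= morphim_restrm finset.setIid -(eA i) morphim_normal.
Qed.

End MelnikovFormations.

(** * Wreath products and the twisted copy of [A] *)

Definition regular_wreath (gT : finGroupType) : Type :=
  ({ffun gT -> gT} * gT)%type.

Section RegularWreath.
Variable gT : finGroupType.
Local Notation wT := (regular_wreath gT).
Implicit Types u v w : wT.

HB.instance Definition _ := Finite.copy wT ({ffun gT -> gT} * gT)%type.

(** The top group acts by right translation of the argument, which preserves invariance under left
    multiplication by [A]. *)
Definition wreath_mul u v : wT := ([ffun y => u.1 y * v.1 (y * u.2)], u.2 * v.2).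
Definition wreath_one : wT := ([ffun=> 1], 1).
Definition wreath_inv u : wT := ([ffun y => (u.1 (y * u.2^-1))^-1], u.2^-1).

Lemma wreath_mulA : associative wreath_mul.
Proof.
move=> u v w; congr pair => /=; last by rewrite mulgA.
by apply/ffunP => y; rewrite !ffunE /= !mulgA.
Qed.

Lemma wreath_mul1 : left_id wreath_one wreath_mul.
Proof.
move=> [f b]; congr pair => /=; last by rewrite mul1g.
by apply/ffunP => y; rewrite !ffunE /= mulg1 mul1g.
Qed.

Lemma wreath_mulV : left_inverse wreath_one wreath_inv wreath_mul.
Proof.
move=> u; congr pair => /=; last by rewrite mulVg.
by apply/ffunP => y; rewrite !ffunE /= mulVg.
Qed.

HB.instance Definition _ :=
  Finite_isGroup.Build wT wreath_mulA wreath_mul1 wreath_mulV.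

Lemma wreathM1 u v y : (u * v).1 y = u.1 y * v.1 (y * u.2).
Proof. by rewrite ffunE. Qed.

Lemma wreath1 y : (1 : wT).1 y = 1.
Proof. by rewrite ffunE. Qed.

(** [D] records the domain, so that both [coset_wreath] and the image of [twisted_section] get a
    projection morphism. *)
Definition wreath_proj (D : {set wT}) u : gT := u.2.

Lemma wreath_projM (D : {set wT}) : {in D &, {morph wreath_proj D : u v / u * v}}.
Proof. by []. Qed.

Canonical wreath_proj_morphism D := Morphism (@wreath_projM D).

Variables (A B : {group gT}).

(* A wr B, the base group being the A-valued functions on the right cosets of A. *)
Definition coset_wreath : {set wT} :=
  [set u : wT | [&& u.2 \in B, [forall y, u.1 y \in A]
             & [forall a in A, forall y, u.1 (a * y) == u.1 y]]].

Lemma coset_wreathP u :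
  reflect [/\ u.2 \in B, forall y, u.1 y \in A
            & forall a y, a \in A -> u.1 (a * y) = u.1 y]
          (u \in coset_wreath).
Proof.
rewrite inE; apply: (iffP and3P) => -[uB uA uc]; split=> //; try exact/forallP.
  by move=> a y aA; apply/eqP; move: y; apply/forallP; exact: (forall_inP uc).
by apply/forall_inP => a aA; apply/forallP => y; rewrite uc.
Qed.

Lemma coset_wreath_group_set : group_set coset_wreath.
Proof.
apply/group_setP; split=> [|u v /coset_wreathP[uB uA uc] /coset_wreathP[vB vA vc]].
  by apply/coset_wreathP; split=> [|y|a y _]; rewrite ?wreath1 ?group1.
apply/coset_wreathP; split=> [|y|a y aA]; rewrite ?wreathM1 ?groupM //.
by rewrite uc // -mulgA vc.
Qed.

Canonical coset_wreath_group := Group coset_wreath_group_set.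

Definition twisted_section (a : gT) : wT := ([ffun y => if y \in A then a else 1], a).

Lemma twisted_section1 a y : (twisted_section a).1 y = if y \in A then a else 1.
Proof. by rewrite ffunE. Qed.

(** Right translation by an element of [A] preserves [A] and its complement, so values multiply on
    [A] and stay 1 elsewhere. *)
Lemma twisted_sectionM : {in A &, {morph twisted_section : a b / a * b}}.
Proof.
move=> a b aA bA; congr pair; apply/ffunP => y; rewrite ffunE wreathM1.
by rewrite !twisted_section1 /= groupMr //; case: ifP; rewrite ?mulg1.
Qed.

Canonical twisted_section_morphism := Morphism twisted_sectionM.

Lemma injm_twisted_section : 'injm twisted_section.
Proof. by apply/injmP => a b _ _ /(congr1 snd). Qed.

Lemma wreath_proj_twisted_section :
  wreath_proj (twisted_section @* A) @* (twisted_section @* A) = A.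
Proof.
apply/finset.setP => a; apply/idP/idP => [/morphimP[u _ /morphimP[b _ bA ->] ->] //|aA].
have sA : twisted_section a \in twisted_section @* A by rewrite mem_morphim.
exact: (mem_morphim (wreath_proj_morphism (twisted_section @* A)) sA sA).
Qed.

Lemma twisted_section_sub : A \subset B -> twisted_section @* A \subset coset_wreath.
Proof.
move=> sAB; apply/fintype.subsetP => _ /morphimP[a _ aA ->].
apply/coset_wreathP; split=> [|y|b y bA]; rewrite ?(fintype.subsetP sAB) //.
  by rewrite twisted_section1; case: ifP.
by rewrite !twisted_section1 groupMl.
Qed.

Lemma wreath_proj_coset_wreath : wreath_proj coset_wreath @* coset_wreath = B.
Proof.
apply/finset.setP => b; apply/idP/idP => [/morphimP[u _ /coset_wreathP[uB _ _] ->] //|bB].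
have bW : (([ffun=> 1], b) : wT) \in coset_wreath.
  by apply/coset_wreathP; split=> [//|y|a y _]; rewrite !ffunE.
exact: (mem_morphim (wreath_proj_morphism coset_wreath) bW bW).
Qed.

Definition wreath_eval (y : gT) u : gT := u.1 y.

Lemma wreath_evalM y :
  {in 'ker (wreath_proj coset_wreath) &, {morph wreath_eval y : u v / u * v}}.
Proof.
move=> u v /mker; rewrite /wreath_proj /wreath_eval => u1 _.
by rewrite wreathM1 u1 mulg1.
Qed.

Canonical wreath_eval_morphism y := Morphism (@wreath_evalM y).

Lemma wreath_eval_ker y : wreath_eval y @* 'ker (wreath_proj coset_wreath) = A.
Proof.
apply/finset.setP => a; apply/idP/idP => [/morphimP[u _ /dom_ker/coset_wreathP[_ uA _] ->]|aA].
  exact: uA.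
pose u : wT := ([ffun=> a], 1).
have uW : u \in coset_wreath by apply/coset_wreathP; split=> //= *; rewrite !ffunE.
have uK : u \in 'ker (wreath_proj coset_wreath) by apply/kerP.
have -> : a = wreath_eval y u by rewrite /wreath_eval ffunE.
exact: mem_morphim.
Qed.

(** The wreath product is an extension of [B] by the base group, which the evaluations embed in a
    power of [A]; constant functions show that each evaluation is onto [A]. *)
Lemma melnikov_coset_wreath (C : finite_group_family) : melnikov_formation C ->
  C gT A -> C gT B -> C wT coset_wreath_group.
Proof.
move=> hC CA CB.
apply/(melnikov_extension hC (K := ('ker (wreath_proj coset_wreath))%G) erefl).
split; last first.
  by congr (C _): CB; apply/val_inj; rewrite /= wreath_proj_coset_wreath.
apply: (melnikov_subpower hC (e := wreath_eval_morphism) _ _ CA).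
  exact: wreath_eval_ker.
move=> u /mker u2 u1; rewrite [u]surjective_pairing; congr pair => //.
by apply/ffunP => y; rewrite ffunE; exact: u1.
Qed.

End RegularWreath.

Local Open Scope classical_set_scope.

(** * Clopen neighbourhoods in compact spaces *)

Section CompactSpaces.
Variable T : topologicalType.
Hypothesis cptT : compact [set: T].

(** If no [D] works, the traces of the clopen neighbourhoods of [x] on the complement of [O]
    generate a proper filter. Its cluster point lies outside [O], so some clopen set separates it
    from [x], a contradiction. *)
Lemma clopen_subset_open (x : T) (O : set T) : open O ->
  (forall y, ~ O y -> exists D, [/\ clopen D, D x & ~ D y]) ->
  exists D, [/\ clopen D, D x & D `<=` O].
Proof.
move=> oO sep; apply: contrapT => noD.
pose F := filter_from [set D : set T | clopen D /\ D x] (fun D => D `&` ~` O).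
have FF : ProperFilter F.
  apply: filter_from_proper => [|D [cD Dx]].
    apply: filter_from_filter; first by exists setT; split=> //; exact: clopenT.
    move=> A B [cA Ax] [cB Bx]; exists (A `&` B); first by split=> //; exact: clopenI.
    by rewrite setIACA setIid.
  apply: contrapT => /nonemptyPn DO; apply: noD; exists D; split=> //.
  by move/disjoints_subset: DO; rewrite setCK.
have [y [_ clFy]] := cptT FF filterT.
have nOy : ~ O y.
  move=> Oy; have FO : F (~` O).
    by exists setT; rewrite ?setTI //; split=> //; exact: clopenT.
  by have [z [nOz Oz]] := clFy _ _ FO (open_nbhs_nbhs (conj oO Oy)).
have [D [cD Dx nDy]] := sep y nOy.
have FD : F D by exists D => // z [].
have nD : nbhs y (~` D).
  by apply: open_nbhs_nbhs; split=> //; apply: closed_openC; case: cD.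
by have [z [Dz nDz]] := clFy _ _ FD nD.
Qed.

Lemma compact_finite_cover (N : T -> set T) : (forall x, nbhs x (N x)) ->
  exists s : seq T, forall x, exists2 r, r \in s & N r x.
Proof.
move=> Nx.
(* The filter of sufficiently large finite lists; the near-covering form of compactness along it
   gives one list for all points. *)
pose F := filter_from [set: seq T] (fun s => [set s' : seq T | {subset s <= s'}]).
have FF : Filter F.
  apply: filter_from_filter; first by exists [::].
  move=> s t _ _; exists (s ++ t) => // u stu.
  by split=> z zs; apply: stu; rewrite mem_cat zs ?orbT.
have := (compact_near_coveringP _).1 cptT _ F
  (fun s x => exists2 r, r \in s & N r x) FF.
case=> [x _|s _ /(_ s) scov].
  exists (N x, [set s | x \in s]) => /=; last by move=> [y s] [/= ? ?]; exists x.
  by split=> //; exists [:: x] => // s; apply; rewrite inE.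
by exists s => x; apply: scov.
Qed.

Hypothesis hsdfT : hausdorff_space T.

(* The intersection Q of the clopen neighbourhoods of x is connected: if B
   is clopen in Q and contains x, normality separates B from Q \ B by open sets,
   and some clopen neighbourhood of x lies in their union. *)
Lemma totally_disconnected_zero_dimensional :
  totally_disconnected [set: T] -> zero_dimensional T.
Proof.
move=> tdT x y xy; apply: contrapT => nsep.
pose Q := \bigcap_(D in [set D : set T | clopen D /\ D x]) D.
have Qx : Q x by move=> D [].
have clQ : closed Q by apply: closed_bigI => D [[]].
have Qy : Q y.
  by move=> D [cD Dx]; apply: contrapT => nDy; apply: nsep; exists D.
have key (B : set T) : B x -> closed B -> closed (Q `\` B) -> B `<=` Q -> Q `<=` B.
  move=> Bx clB clQB BQ.
  have : set_nbhs B (~` (Q `\` B)).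
    apply/set_nbhsP; exists (~` (Q `\` B)); split=> //; first exact: closed_openC.
    by move=> z Bz [].
  move/(compact_normal hsdfT cptT clB) => [W /set_nbhsP[O [oO BO OW]] clW].
  have oO2 : open (~` closure W) by apply: closed_openC; exact: closed_closure.
  have [z|D [[oD cD] Dx DO]] :=
      @clopen_subset_open x (O `|` ~` closure W) (openU oO oO2).
    move=> /not_orP[nOz /contrapT clWz].
    have nQz : ~ Q z.
      by move=> Qz; apply: (clW z clWz); split=> // /BO.
    apply: contrapT => nsepz; apply: nQz => D [cD Dx].
    by apply: contrapT => nDz; apply: nsepz; exists D.
  (* Each point of [D] is in [O] or outside [closure W], so the part of [D] in [O] is closed as well
     as open. *)
  have DOE : D `&` O = D `&` closure W.
    apply/seteqP; split=> z [Dz].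
      by move=> /OW Wz; split=> //; exact: subset_closure.
    by move=> clWz; split=> //; case: (DO z Dz).
  have cDO : clopen (D `&` O).
    split; first exact: openI.
    by rewrite DOE; apply: closedI => //; exact: closed_closure.
  move=> z Qz; apply: contrapT => nBz.
  have [_ Oz] : (D `&` O) z by apply: Qz; split=> //; split=> //; exact: BO.
  exact: (clW z (subset_closure (OW z Oz))).
have cQ : connected Q.
  move=> B [b Bb] [C1 oC1 BC1] [C2 cC2 BC2].
  have clB : closed B by rewrite BC2; exact: closedI.
  have BQ : B `<=` Q by rewrite BC1 => z [].
  have QBE : Q `\` B = Q `&` ~` C1.
    apply/seteqP; split=> z [Qz nz]; split=> //.
      by move=> C1z; apply: nz; rewrite BC1.
    by rewrite BC1 => -[].
  have clQB : closed (Q `\` B).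
    by rewrite QBE; apply: closedI => //; exact: open_closedC.
  apply/seteqP; split=> //; have [Bx|nBx] := pselect (B x); first exact: key.
  (* When [x] is not in [B], [key] applies to the complement of [B] in [Q] and contradicts that [B]
     is nonempty. *)
  have QQB : Q `<=` Q `\` B.
    have QQBE : Q `\` (Q `\` B) = B by rewrite setDD; exact/setIidPr.
    by apply: (key (Q `\` B)); rewrite ?QQBE //; exact: subDsetl.
  by have [] := QQB b (BQ b Bb).
have := connected_component_max Qx (@subsetT _ Q) cQ Qy.
by rewrite tdT // => /= yx; move/eqP: xy; apply.
Qed.

Lemma profinite_clopen_nbhs (x : T) (O : set T) :
  totally_disconnected [set: T] -> open O -> O x ->
  exists D, [/\ clopen D, D x & D `<=` O].
Proof.
move=> /totally_disconnected_zero_dimensional zdT oO Ox.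
apply: clopen_subset_open => // y nOy.
by apply: zdT; apply: contra_notN nOy => /eqP <-.
Qed.

End CompactSpaces.

(** * Finite quotients of a profinite group *)

Section FiniteQuotients.
Variable L : topologicalGroupType.
Implicit Types (U V : set L) (x y u : L).

Lemma mulg_cvg (S : Type) (F : set_system S) (f g : S -> L) x y : Filter F ->
  f @ F --> x -> g @ F --> y -> (fun s => f s * g s) @ F --> x * y.
Proof.
move=> FF fx gy; apply: continuous2_cvg fx gy.
exact: (@mulg_continuous L (x, y)).
Qed.

Lemma mulgl_continuous x : continuous (fun y : L => x * y).
Proof. by move=> y; apply: mulg_cvg; [exact: cvg_cst|exact: cvg_id]. Qed.

(* The largest normal subgroup of which V is a union of cosets. *)
Definition syntactic_kernel V : set L :=
  [set u | forall a b, V (a * u * b) <-> V (a * b)].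

Lemma syntactic_kernel1 V : syntactic_kernel V 1.
Proof. by move=> a b; rewrite mulg1. Qed.

Lemma syntactic_kernelM V x y :
  syntactic_kernel V x -> syntactic_kernel V y -> syntactic_kernel V (x * y).
Proof.
move=> Vx Vy a b; rewrite mulgA; split=> [/Vy/Vx //|Vab].
by apply/Vy/Vx.
Qed.

Lemma syntactic_kernelV V x : syntactic_kernel V x -> syntactic_kernel V x^-1.
Proof.
move=> Vx a b; split=> [Vaxb|Vab].
  by have := (Vx (a * x^-1) b).2 Vaxb; rewrite mulgKV.
by apply: (Vx _ _).1; rewrite mulgKV.
Qed.

Lemma syntactic_kernelJ V x y : syntactic_kernel V x -> syntactic_kernel V (x ^ y).
Proof.
move=> Vx a b; have := Vx (a * y^-1) (y * b).
by rewrite conjgE !mulgA mulgKV.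
Qed.

Lemma syntactic_kernel_sub V : V 1 -> syntactic_kernel V `<=` V.
Proof. by move=> V1 u /(_ 1 1); rewrite !mul1g mulg1 => ->. Qed.

(** A tube argument: near a given pair [(a, b)] and for [u] near 1, [a * u * b] and [a * b] lie on
    the same side of the clopen [V]; compactness of [L * L] makes the choice of [u] uniform. *)
Lemma syntactic_kernel_nbhs V : compact [set: L] -> clopen V ->
  nbhs 1 (syntactic_kernel V).
Proof.
move=> cptL [oV cV].
have cptLL : compact [set: L * L] by rewrite -setXTT; exact: compact_setX.
pose P (u : L) (ab : L * L) := V (ab.1 * u * ab.2) <-> V (ab.1 * ab.2).
suff : \forall u \near (1 : L), [set: L * L] `<=` P u.
  by apply: filterS => u PuT a b; exact: (PuT (a, b)).
apply: ((compact_near_coveringP _).1 cptLL) => -[a b] _.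
have mul2 : (fun z : (L * L) * L => z.1.1 * z.1.2) @ ((a, b), (1 : L)) --> a * b.
  apply: mulg_cvg.
    by apply: cvg_comp; [exact: cvg_fst|exact: cvg_fst].
  by apply: cvg_comp; [exact: cvg_fst|exact: cvg_snd].
have mul3 : (fun z : (L * L) * L => z.1.1 * z.2 * z.1.2) @ ((a, b), (1 : L))
    --> a * 1 * b.
  apply: mulg_cvg; last by apply: cvg_comp; [exact: cvg_fst|exact: cvg_snd].
  apply: mulg_cvg; last exact: cvg_snd.
  by apply: cvg_comp; [exact: cvg_fst|exact: cvg_fst].
rewrite mulg1 in mul3.
have [Vab|nVab] := pselect (V (a * b)).
  have nV : nbhs (a * b) V by apply: open_nbhs_nbhs.
  by near=> z => /=; split=> _; near: z; [exact: mul2|exact: mul3].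
have nV : nbhs (a * b) (~` V).
  by apply: open_nbhs_nbhs; split=> //; exact: closed_openC.
near=> z => /=.
have z2 : (~` V) (z.1.1 * z.1.2) by near: z; exact: mul2.
have z3 : (~` V) (z.1.1 * z.2 * z.1.2) by near: z; exact: mul3.
by split=> [/z3|/z2].
Unshelve. all: by end_near. Qed.

(** [L] acts by right multiplication on the cosets of a normal syntactic kernel [U] inside [O];
    compactness makes these finitely many, and [nu] is the resulting permutation representation. *)
Lemma finite_quotient_nbhs (O : set L) : profinite L -> open O -> O 1 ->
  exists (gT : finGroupType) (nu : L -> gT),
    [/\ {morph nu : x y / x * y},
        continuous (nu : L -> discrete_topology gT) &
        forall x, nu x = 1 -> O x].
Proof.
move=> [cptL hsdfL tdL] oO O1.
have [V [cV V1 VO]] := profinite_clopen_nbhs cptL hsdfL tdL oO O1.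
pose U := syntactic_kernel V; have U1 : U 1 by exact: syntactic_kernel1.
have UM x y : U x -> U y -> U (x * y) by exact: syntactic_kernelM.
have UV x : U x -> U x^-1 by exact: syntactic_kernelV.
have UJ x y : U x -> U (x ^ y) by exact: syntactic_kernelJ.
have coset_nbhs x : nbhs x [set y | U (x^-1 * y)].
  have := syntactic_kernel_nbhs cptL cV; rewrite -(mulVg x).
  exact: mulgl_continuous.
have [s scov] := compact_finite_cover cptL coset_nbhs.
have ex_rep x : exists r, `[< U (r^-1 * x) >].
  by exists x; apply/asboolP; rewrite mulVg.
(* [xchoose] agrees on extensionally equal predicates, so [rep x] depends only on the coset of
   [x]. *)
pose rep x := xchoose (ex_rep x).
have repP x : U ((rep x)^-1 * x) by exact/asboolP/(xchooseP (ex_rep x)).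
have eq_rep x y : U (x^-1 * y) -> rep x = rep y.
  move=> Uxy; apply: eq_xchoose => r; apply: asbool_equiv_eq; split=> Ur.
    by rewrite -(mulKVg x y) mulgA; exact: UM.
  have -> : r^-1 * x = r^-1 * y * (x^-1 * y)^-1 by rewrite invMg invgK mulgA mulgK.
  by apply: UM => //; exact: UV.
(* Normality enters here: the two products differ by the conjugate by [y] of an element of [U]. *)
have repM x y : rep (rep x * y) = rep (x * y).
  apply: eq_rep; rewrite invMg -mulgA (mulgA _ x) -conjgE.
  exact: UJ.
have mem_rep x : rep x \in map rep s.
  by have [r rs Urx] := scov x; rewrite -(eq_rep _ _ Urx) map_f.
pose T := seq_sub (map rep s).
pose act x (c : T) : T := SeqSub (mem_rep (val c * x)).
have val_rep (c : T) : rep (val c) = val c.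
  have /mapP[r _ ->] := valP c.
  exact: eq_rep.
have actM x y c : act y (act x c) = act (x * y) c.
  by apply: val_inj; rewrite /= repM mulgA.
have act1 c : act 1 c = c by apply: val_inj; rewrite /= mulg1 val_rep.
have actK x : cancel (act x) (act x^-1) by move=> c; rewrite actM mulgV act1.
exists {perm T}, (fun x => perm (can_inj (actK x))); split.
- by move=> x y; apply/permP => c; rewrite permM !permE actM.
- move=> x; apply/discrete_cvg; apply: filterS (coset_nbhs x) => y /= Uxy.
  apply/permP => c; rewrite !permE; apply/esym/val_inj/eq_rep.
  by rewrite invMg -mulgA mulKg.
(* Fixing the coset of 1 already forces [x] into [U]. *)
- move=> x /permP/(_ (SeqSub (mem_rep 1))); rewrite permE perm1 => /(congr1 val).
  rewrite /= repM mul1g => rx1; suff Ux : U x by apply: VO; exact: syntactic_kernel_sub Ux.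
  rewrite -(mulKVg (rep x) x); apply: UM => //; rewrite rx1.
  by have := UV _ (repP 1); rewrite mulg1 invgK.
Qed.

End FiniteQuotients.

(** * Malnormality from the wreath product embedding problem *)

Lemma closed_subgroup_epi (L : topologicalGroupType) (S : set L)
    (gT : finGroupType) (nu : L -> gT) :
    closed_subgroup S -> {morph nu : x y / x * y} ->
    continuous (nu : L -> discrete_topology gT) ->
  exists A : {group gT}, continuous_epi S A nu.
Proof.
move=> [S1 SM _ _] nuM nuC.
pose A := [set a : gT | `[< exists2 x, S x & nu x = a >]]%SET.
have AP a : reflect (exists2 x, S x & nu x = a) (a \in A).
  by rewrite finset.in_set; exact: asboolP.
have gA : group_set A.
  apply/group_setP; split=> [|a b /AP[x Sx <-] /AP[y Sy <-]].
    by apply/AP; exists 1 => //; apply: (mulgI (nu 1)); rewrite -nuM !mulg1.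
  by apply/AP; exists (x * y); [exact: SM|rewrite nuM].
have nuS : nu @` S = [set` A] by apply/seteqP; split=> a /AP.
exists (Group gA); split=> //; split=> [x y _ _||]; [exact: nuM|by rewrite nuS|].
exact: continuous_subspaceT.
Qed.

Lemma closed_subgroupT (L : topologicalGroupType) : closed_subgroup [set: L].
Proof. by split. Qed.

Lemma projective_pair_malnormal (C : finite_group_family)
    (L : topologicalGroupType) (Gam : set L) (x g : L) :
    melnikov_formation C -> profinite L -> closed_subgroup Gam ->
    pro_family C [set: L] -> pro_family C Gam -> projective_pair C Gam ->
  ~ Gam x -> Gam g -> Gam (g ^ x) -> g = 1.
Proof.
move=> hC hL hGam proL proGam proj nGx Gg Ggx; apply: contrapT => g1.
have [_ _ _ clG] := hGam.
(* If [nu x = nu y] with [y] in [Gam], then [x^-1 * y] is in the kernel of [nu] but violates the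
   first condition; the second one excludes [nu (g ^ x) = 1]. *)
pose O : set L := [set u | ~ Gam (x * u)] `&` ~` [set g ^ x].
have oO : open O.
  apply: openI.
    apply: (open_comp (f := fun u => x * u) (D := ~` Gam)); last exact: closed_openC.
    by move=> u _; exact: mulgl_continuous.
  apply/closed_openC/accessible_closed_set1/hausdorff_accessible.
  by case: hL.
have O1 : O 1.
  by split=> /=; rewrite ?mulg1 // => /esym/eqP; rewrite conjg_eq1 => /eqP.
have [gT [nu [nuM nuC nuO]]] := finite_quotient_nbhs hL oO O1.
have [A epiA] := closed_subgroup_epi hGam nuM nuC.
have [B epiB] := closed_subgroup_epi (closed_subgroupT L) nuM nuC.
have nu1 : nu 1 = 1 by apply: (mulgI (nu 1)); rewrite -nuM !mulg1.
have nuV y : nu y^-1 = (nu y)^-1 by apply: (mulgI (nu y)); rewrite -nuM !mulgV.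
have memA a : a \in A -> exists2 y, Gam y & nu y = a.
  by move=> aA; have : [set` A] a by []; rewrite -epiA.2.
have nuA y : Gam y -> nu y \in A.
  by move=> Gy; suff : [set` A] (nu y) by []; rewrite -epiA.2; exists y.
have nuB y : nu y \in B.
  by suff : [set` B] (nu y) by []; rewrite -epiB.2; exists y.
have sAB : A \subset B by apply/fintype.subsetP => a /memA[y _ <-].
have nuxA : nu x \notin A.
  apply/negP => /memA[y Gy nuyx]; have /nuO[] : nu (x^-1 * y) = 1.
    by rewrite nuM nuV nuyx mulVg.
  by rewrite /= mulKVg.
have nugx : nu (g ^ x) != 1 by apply/eqP => /nuO[_]; apply.
have CA := proGam _ _ _ epiA; have CB := proL _ _ _ epiB.
have CG : C _ (twisted_section A @* A)%G.
  by apply/(melnikov_isom hC (injm_twisted_section A)).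
pose E := DoubleEmbeddingProblem sAB (twisted_section_sub sAB) CA CB CG
  (melnikov_coset_wreath hC CA CB) epiA (wreath_proj_twisted_section A) epiB
  (wreath_proj_coset_wreath A B) (fun _ _ => erefl) (fun _ _ => erefl).
have [eta [theta [[_ etaG _] [thetaM thetaH _] aeta bth the]]] := proj E.
(* The second component determines an element of the image of [twisted_section]. *)
have thetaE y : Gam y -> theta y = twisted_section A (nu y).
  move=> Gy; have yG : y \in Gam by rewrite inE.
  have /etaG : (eta @` Gam) (eta y) by exists y.
  rewrite the //= => /morphimP[a _ _ etaE].
  by have := aeta y yG; rewrite /= etaE => <-.
have th2 : (theta x).2 = nu x by exact: bth.
have /coset_wreathP[_ _ thc] : theta x \in coset_wreath A B.
  by apply: thetaH; exists x.
have : theta (x * g ^ x) = theta (g * x) by rewrite -conjgC.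
rewrite (thetaM x) ?inE // (thetaM g) ?inE // (thetaE g Gg) (thetaE _ Ggx).
(* At this point the factor from [g ^ x] is evaluated at 1, giving [nu (g ^ x)], while the factor
   from [g] is evaluated outside [A], giving 1. *)
move/(congr1 (fun u : regular_wreath gT => u.1 (nu x)^-1)).
rewrite !wreathM1 !twisted_section1 th2 mulVg group1 groupV (negbTE nuxA) mul1g /=.
have -> : (nu x)^-1 * nu g = nu (g ^ x) * (nu x)^-1.
  by rewrite conjgE !nuM nuV mulgA mulgK.
(* As [nu (g ^ x)] is in [A], both sides contain the same value of [theta x], which cancels. *)
rewrite thc ?nuA // => /(canRL (mulKg _)); rewrite mulVg => /eqP.
by rewrite (negbTE nugx).
Qed.

Theorem proposition4p2 (C : finite_group_family) (L : topologicalGroupType)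
    (Gam : set L) (hC : melnikov_formation C) (hL : profinite L)
    (hGam : closed_subgroup Gam)
    (hproL : pro_family C [set: L]) (hproGam : pro_family C Gam)
    (hproj : projective_pair C Gam) (hne : Gam <> [set: L]) :
  \bigcap_(x in [set: L]) [set g ^ x | g in Gam] = [set 1].
Proof.
apply/seteqP; split=> [g gI|_ -> x _]; last first.
  by exists 1; rewrite ?conj1g //; case: hGam.
have [x nGx] : exists x, ~ Gam x.
  apply: contrapT => /forallNP nn; apply/hne/seteqP; split=> // x _.
  by apply: contrapT; exact: nn.
(* Conjugation by 1 puts [g = h ^ x] itself in [Gam], so malnormality applies to [h]. *)
have [h Gh hg] := gI x I; have [k Gk] := gI 1 I; rewrite conjg1 => kg.
rewrite -hg (projective_pair_malnormal hC hL hGam hproL hproGam hproj nGx Gh) ?conj1g //.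
by rewrite hg -kg.
Qed.
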